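(* Let $R$ be a unital commutative ring, let $T=(V,E)$ be a tree with $V=[n]$, and suppose each edge $\{i,j\}\in E$ carries elements $a_{ij}=a_{ji},\,m_{ij},\,m_{ji}\in R$. Let $D_T$ be the directed distance matrix of this data (defined in the context), $J$ the $n\times n$ all-ones matrix and $x$ an indeterminate. Let $I,J'\subseteq V$ satisfy: (a) $|I|=|J'|\le n-3$; (b) $I\cup J'\subsetneq V$; (c) the subgraphs of $T$ induced on $V\setminus I$, on $V\setminus J'$ and on $V\setminus(I\cap J')$ are connected. Let $E_\circ$ be the set of edges of $T$ having no endpoint in $I\cap J'$. Then $\det(D_T+xJ)_{I|J'}$ depends only on the edge-data and not on the tree structure, namely: (i) if $|I\Delta J'|=0$ (i.e. $I=J'$), $$\det(D_T+xJ)_{I|J'}=\prod_{e\in E_\circ}\big(a_e(1-m_em'_e)\big)\Big[x+\sum_{e\in E_\circ}\frac{(a_e-x)(m_e-1)(m'_e-1)}{m_em'_e-1}\Big],$$ where each denominator $m_em'_e-1$ is a placeholder cancelling against the factor $1-m_em'_e$ of the product; explicitly this equals $x\prod_{e\in E_\circ}a_e(1-m_em'_e)-\sum_{e\in E_\circ}a_e(a_e-x)(m_e-1)(m'_e-1)\prod_{f\in E_\circ\setminus\{e\}}a_f(1-m_fm'_f)$; (ii) if $|I\Delta J'|=2$, writing $I\setminus J'=\{i_0\}$ and $J'\setminus I=\{j_0\}$, $$\det(D_T+xJ)_{I|J'}=\prod_{e\in E_\circ\setminus\{\{p(i_0),i_0\},\{j_0,p(j_0)\}\}}\big(a_e(m_em'_e-1)\big)\cdot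 a_{p(i_0)i_0}\,(a_{j_0p(j_0)}-x)\,(m_{p(i_0)i_0}-1)(m_{j_0p(j_0)}-1);$$ (iii) if $|I\Delta J'|>2$, then $\det(D_T+xJ)_{I|J'}=0$.
   Context: For an edge $e=\{i,j\}$ with $i<j$ write $a_e=a_{ij}=a_{ji}$, $m_e=m_{ij}$, $m'_e=m_{ji}$ (the formulas are symmetric in $m_e,m'_e$). The directed distance matrix $D_T\in R^{n\times n}$ is defined as follows: if $i=i_0,i_1,\dots,i_k=j$ is the unique path in $T$ from $i$ to $j$, then $(D_T)_{ij}=\sum_{l=0}^{k-1}a_{i_li_{l+1}}(m_{i_li_{l+1}}-1)\prod_{u=0}^{l-1}m_{i_ui_{u+1}}$ (empty product $=1$; in particular $(D_T)_{ii}=0$). For a matrix $D$ with rows and columns indexed by $V$, $D_{I|J'}$ denotes the submatrix obtained by deleting the rows indexed by $I$ and the columns indexed by $J'$. In case (ii), $p(i_0)$ denotes the unique neighbour of $i_0$ in the tree induced on $V\setminus(I\cap J')$ (in which $i_0$ is a leaf; for $i_0$ a pendant vertex of $T$ it is its unique neighbour in $T$), similarly for $p(j_0)$; $a_{p(i_0)i_0}$, $m_{p(i_0)i_0}$ refer to the direction $p(i_0)\to i_0$, and $a_{j_0p(j_0)}$, $m_{j_0p(j_0)}$ to the direction $j_0\to p(j_0)$; the edges removed from the product are the undirected edges $\{p(i_0),i_0\}$ and $\{j_0,p(j_0)\}$.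
   Formalization: In (ii) the right-hand side is multiplied by the sign (-1)^(#{v in W: v<i_0}+#{v in W: v>j_0}), W=V\(I∩J'), since without it the formula fails, e.g. for the star with centre 1, leaves 2,3,4, I={2}, J'={4}; R is assumed nonzero (trivial otherwise). *)

(* Defs.v *)
From mathcomp Require Import all_boot all_order all_algebra.

Set Implicit Arguments.
Unset Strict Implicit.
Unset Printing Implicit Defensive.

Import GRing.Theory.
Local Open Scope ring_scope.

Definition induced_rel (n : nat) (e : rel 'I_n) (S : {set 'I_n}) : rel 'I_n :=
  [rel u v | [&& u \in S, v \in S & e u v]].

Definition induced_connected (n : nat) (e : rel 'I_n) (S : {set 'I_n}) : Prop :=
  S != set0 /\ {in S &, forall u v, connect (induced_rel e S) u v}.

Record is_tree (n : nat) (e : rel 'I_n) : Prop := IsTree {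
  tree_sym : symmetric e;
  tree_irr : irreflexive e;
  tree_connected : induced_connected e [set: 'I_n];
  (* [ucycle] also accepts [::] and, for a symmetric relation, the
     back-and-forth walk [:: u; v]; graph cycles have at least 3 vertices. *)
  tree_acyclic : forall c : seq 'I_n, ucycle e c -> (size c < 3)%N
}.

(* The tail i_1, .., i_k of a simple path i = i_0, i_1, .., i_k = j; in a tree
   there is exactly one. The default value is only used when there is none. *)
Definition simple_path (n : nat) (e : rel 'I_n) (i j : 'I_n) : seq 'I_n :=
  if [pick p : n.-bseq 'I_n | [&& path e i p, last i p == j & uniq (i :: p)]]
    is Some p then p else [::].

Definition path_weight (R : comNzRingType) (n : nat) (a m : 'I_n -> 'I_n -> R)
    (i : 'I_n) (p : seq 'I_n) : R :=
  let v := nth i (i :: p) in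
  \sum_(l < size p)
    a (v l) (v l.+1) * (m (v l) (v l.+1) - 1) * \prod_(u < l) m (v u) (v u.+1).

Definition directed_distance_mx (R : comNzRingType) (n : nat) (e : rel 'I_n)
    (a m : 'I_n -> 'I_n -> R) : 'M[R]_n :=
  \matrix_(i, j) path_weight a m i (simple_path e i j).

(* D_T + xJ, over R[x] *)
Definition shifted_distance_mx (R : comNzRingType) (n : nat) (e : rel 'I_n)
    (a m : 'I_n -> 'I_n -> R) : 'M[{poly R}]_n :=
  map_mx polyC (directed_distance_mx e a m) + 'X *: const_mx 1.

Lemma eq_card_setC (n : nat) (I J : {set 'I_n}) :
  #|I| = #|J| -> #|~: I| = #|~: J|.
Proof. by move=> eqIJ; rewrite [LHS]cardsCs [RHS]cardsCs !setCK eqIJ. Qed.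

(* Delete the rows in I and the columns in J. [enum_val] is increasing on sets
   of ordinals, so the remaining rows and columns keep their order in [n]. *)
Definition deleted_mx (R : Type) (n : nat) (M : 'M[R]_n) (I J : {set 'I_n})
    (eqIJ : #|I| = #|J|) : 'M[R]_#|~: I| :=
  \matrix_(r, c) M (enum_val r) (enum_val (cast_ord (eq_card_setC eqIJ) c)).

(* An undirected edge {u, v} is represented by its increasing pair. *)
Definition edge (n : nat) (u v : 'I_n) : 'I_n * 'I_n :=
  if (u < v)%N then (u, v) else (v, u).

Definition edges_in (n : nat) (e : rel 'I_n) (S : {set 'I_n}) :
    {set 'I_n * 'I_n} :=
  [set f : 'I_n * 'I_n | [&& (f.1 < f.2)%N, e f.1 f.2, f.1 \in S & f.2 \in S]].

Definition symdiff (n : nat) (I J : {set 'I_n}) : {set 'I_n} :=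
  (I :\: J) :|: (J :\: I).

Definition neighbours_in (n : nat) (e : rel 'I_n) (S : {set 'I_n}) (v : 'I_n) :
    {set 'I_n} :=
  [set u in S | e v u].

(* Main.v *)
Require Import Defs.
From mathcomp Require Import all_boot all_order all_algebra all_fingroup ring.

Set Implicit Arguments.
Unset Strict Implicit.
Unset Printing Implicit Defensive.

Import GRing.Theory.
Local Open Scope ring_scope.

(** Write [F = D_T + xJ], and let [P i j] be the product of the [m]'s along the
    path from [i] to [j]. If [w] is a leaf of a subtree, with neighbour [p], then
    on that subtree row [w] of [F] is [m w p] times row [p], plus the constant
    [(a - x) (m w p - 1)], plus [a (1 - m w p * m p w)] on the diagonal; and off
    row [w], column [w] is column [p] plus [a (m p w - 1)] times the column
    [P _ p]. Peeling leaves other than [q] with the row operation shows that [F]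
    on a subtree [C], bordered by a row of ones, by the column [P _ q] and by the
    corner [0], has determinant [- \prod_e a_e (1 - m_e m'_e)]. One row and one
    column operation reduce cases (i) (by induction on leaves) and (ii) to this
    bordered determinant. In case (iii) every row indexed by [J' :\: I] is, on
    the remaining columns, a multiple of another row plus a constant row; two
    constant rows make the determinant vanish. *)

(** * Determinants on subsets of the index set *)

Section SetDet.

Variables (K : comNzRingType) (n : nat).
Implicit Types (W : {set 'I_n}) (F G H : 'I_n -> 'I_n -> K).

(** The identity padding outside [W] keeps every matrix of size [n], so that minors over different
    subsets are compared without reindexing. *)
Definition set_mx W F : 'M[K]_n :=
  \matrix_(i, j) if (i \in W) && (j \in W) then F i j else (i == j)%:R.

Definition set_det W F : K := \det (set_mx W F).

Lemma eq_set_det W F G :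
  {in W &, forall i j, F i j = G i j} -> set_det W F = set_det W G.
Proof.
move=> FG; congr (\det _); apply/matrixP=> i j; rewrite !mxE.
by case: ifP => // /andP[Wi Wj]; rewrite FG.
Qed.

Lemma set_det0 F : set_det set0 F = 1.
Proof.
rewrite -(det1 K n); congr (\det _); apply/matrixP=> i j.
by rewrite !mxE inE.
Qed.

Lemma set_det_tr W F : set_det W (fun i j => F j i) = set_det W F.
Proof.
rewrite -[RHS]det_tr; congr (\det _); apply/matrixP=> i j.
by rewrite !mxE andbC eq_sym.
Qed.

Definition row_upd F (r : 'I_n) (g : 'I_n -> K) : 'I_n -> 'I_n -> K :=
  fun i j => if i == r then g j else F i j.

Definition col_upd F (c : 'I_n) (g : 'I_n -> K) : 'I_n -> 'I_n -> K :=
  fun i j => if j == c then g i else F i j.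

Lemma set_det_row_lin W F r b c g h : r \in W ->
    {in W, forall j, F r j = b * g j + c * h j} ->
  set_det W F = b * set_det W (row_upd F r g) + c * set_det W (row_upd F r h).
Proof.
move=> Wr Fr; apply: (determinant_multilinear (i0 := r)).
- apply/rowP=> j; rewrite !mxE /row_upd eqxx Wr /=; case: ifPn => [/Fr // | Wj].
  suff /negPf-> : r != j by rewrite !mulr0 addr0.
  by apply: contraNneq Wj => <-.
- by apply/matrixP=> i j; rewrite !mxE /row_upd eq_sym (negPf (neq_lift _ _)).
- by apply/matrixP=> i j; rewrite !mxE /row_upd eq_sym (negPf (neq_lift _ _)).
Qed.

Lemma set_det_row_alt W F r s : r != s -> r \in W -> s \in W ->
  {in W, forall j, F r j = F s j} -> set_det W F = 0.
Proof.
move=> rs Wr Ws Frs; apply: (determinant_alternate rs) => j.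
rewrite !mxE Wr Ws /=; case: ifPn => [/Frs // | Wj].
have nj t : t \in W -> t == j = false.
  by move=> Wt; apply: contraNF Wj => /eqP<-.
by rewrite !nj.
Qed.

Lemma set_det_row_op W F r s b c g : r != s -> r \in W -> s \in W ->
    {in W, forall j, F r j = b * F s j + c * g j} ->
  set_det W F = c * set_det W (row_upd F r g).
Proof.
move=> rs Wr Ws Fr; rewrite (set_det_row_lin Wr Fr).
rewrite (set_det_row_alt (r := r) (s := s)) ?mulr0 ?add0r // => j _.
by rewrite /row_upd eqxx eq_sym (negPf rs).
Qed.

Lemma set_det_col_op W F r s b c g : r != s -> r \in W -> s \in W ->
    {in W, forall i, F i r = b * F i s + c * g i} ->
  set_det W F = c * set_det W (col_upd F r g).
Proof.
move=> rs Wr Ws Fr; rewrite -set_det_tr -(set_det_tr W (col_upd _ _ _)).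
exact: (set_det_row_op rs Wr Ws Fr).
Qed.

(** Row [v] is a unit row on both sides, by hypothesis for [W] and by the padding for [W :\ v]; both
    determinants are then the cofactor at [(v, v)], which does not see the index [v]. *)
Lemma set_det_row_unit W F v : v \in W ->
  {in W, forall j, F v j = (v == j)%:R} -> set_det W F = set_det (W :\ v) F.
Proof.
move=> Wv Fv; have cofE (U : {set 'I_n}) : {in U, forall j, F v j = (v == j)%:R} ->
    set_det U F = cofactor (set_mx U F) v v.
  move=> Uv; rewrite /set_det (expand_det_row _ v) (bigD1 v) //= big1 => [|j jv].
    by rewrite addr0 mxE eqxx; case: ifP => [/andP[/Uv->]|]; rewrite ?eqxx mul1r.
  rewrite mxE; have vj : v == j = false by rewrite eq_sym (negPf jv).
  by case: ifP => [/andP[_ /Uv->]|_]; rewrite vj mul0r.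
rewrite !cofE // => [|j /setD1P[_ /Fv] //]; congr (_ * \det _).
by apply/matrixP=> i j; rewrite !mxE !inE ![_ == v]eq_sym !neq_lift.
Qed.

Lemma set_det_tperm W F r s : r != s -> r \in W -> s \in W ->
  set_det W (fun i j => F i (tperm r s j)) = - set_det W F.
Proof.
move=> rs Wr Ws.
have Wt j : (tperm r s j \in W) = (j \in W).
  by case: tpermP => [->|->|//]; rewrite Wr Ws.
(* The padding is twisted so that the column permutation turns it back into the identity; in columns
   [r] and [s], either padding vanishes at the rows outside [W]. *)
have ->: set_det W (fun i j => F i (tperm r s j)) = \det (col_perm (tperm r s)
    (\matrix_(i, j) if (i \in W) && (j \in W) then F i j
                    else (i == tperm r s j)%:R)).
  congr (\det _); apply/matrixP=> i j; rewrite !mxE Wt.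
  by case: ifP; rewrite // tpermK.
rewrite col_permE det_mulmx det_perm odd_permV odd_tperm rs expr1 mulrN1.
congr (- \det _); apply/matrixP=> i j; rewrite !mxE.
case: ifPn => //; case: tpermP => // -> ; rewrite ?Wr ?Ws andbT => Wi.
  suff [-> ->] : (i == s = false) * (i == r = false) by [].
  by split; apply: contraNF Wi => /eqP->.
suff [-> ->] : (i == s = false) * (i == r = false) by [].
by split; apply: contraNF Wi => /eqP->.
Qed.

End SetDet.

(** Induction on [n]. A vertex [v] outside the image contributes a unit row, and [f] factors through
    [lift v]; if there is none, [f] permutes rows and columns alike and the two signs cancel. *)
Lemma set_det_inj (K : comNzRingType) (n k : nat) (f : 'I_k -> 'I_n)
    (F : 'I_n -> 'I_n -> K) : injective f ->
  \det (\matrix_(i, j) F (f i) (f j)) = set_det [set v in codom f] F.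
Proof.
elim: n => [|n IHn] in f F *; move=> injf.
  case: k => [|k] in f injf *; first by rewrite /set_det !det_mx00.
  by case: (f ord0).
case: (pickP [pred v | v \notin codom f]) => [v /= nv | surjf].
  have [g fE] : exists g : 'I_k -> 'I_n, forall i, f i = lift v (g i).
    apply: (@fin_all_exists _ (fun _ => 'I_n) (fun i j => f i = lift v j)) => i.
    case: (unliftP v (f i)) => [j ->|fiv]; first by exists j.
    by rewrite -fiv codom_f in nv.
  have injg : injective g by move=> i j gij; apply: injf; rewrite !fE gij.
  rewrite /set_det (expand_det_row _ v) (bigD1 v) //= big1 ?addr0 => [|j jv].
    rewrite mxE !inE (negPf nv) eqxx mul1r /cofactor addnn -signr_odd.
    rewrite odd_double mul1r.
    rewrite -[LHS](_ : \det (\matrix_(i, j) F (lift v (g i)) (lift v (g j))) = _).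
      rewrite (IHn g (fun i j => F (lift v i) (lift v j)) injg).
      congr (\det _); apply/matrixP=> i j; rewrite !mxE !inE (inj_eq lift_inj).
      suff gf l : (lift v l \in codom f) = (l \in codom g) by rewrite !gf.
      apply/codomP/codomP => -[t]; rewrite ?fE; first by move/lift_inj=> ->; exists t.
      by move=> ->; exists t; rewrite fE.
    by congr (\det _); apply/matrixP=> i j; rewrite !mxE !fE.
  by rewrite mxE !inE (negPf nv) eq_sym (negPf jv) mul0r.
have allf v : v \in codom f by move/negbFE: (surjf v).
have kn : k = n.+1.
  rewrite -(card_ord k) -(card_codom injf) -[RHS]card_ord.
  by apply: eq_card => v; rewrite allf inE.
subst k; pose s := perm injf.
have -> : \matrix_(i, j) F (f i) (f j)
    = row_perm s (col_perm s (set_mx [set v in codom f] F)).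
  by apply/matrixP=> i j; rewrite !mxE !inE !allf /= !permE.
rewrite row_permE col_permE !det_mulmx !det_perm odd_permV mulrCA.
by rewrite -signr_addb addbb mulr1.
Qed.

(** * Paths and subtrees *)

Section Tree.

Variables (n : nat) (e : rel 'I_n).
Hypothesis tree_e : is_tree e.
Implicit Types (C W : {set 'I_n}) (p q : seq 'I_n).

Let e_sym : symmetric e := tree_sym tree_e.

Lemma rev_path_sym i p : path e (last i p) (rev (belast i p)) = path e i p.
Proof. by rewrite rev_path; apply: eq_path => u v; rewrite /= e_sym. Qed.

(** If the paths part at [x != y], walk from [x] along [p] to the common end and back along [q] to
    [y]. This walk avoids [i]; shortened and closed up through [i], it is a cycle with at least 3
    vertices. *)
Lemma uniq_path_inj i p q :
    path e i p -> uniq (i :: p) -> path e i q -> uniq (i :: q) ->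
  last i p = last i q -> p = q.
Proof.
elim: p q i => [|x p IHp] [|y q] i //.
- by move=> _ _ _ /= /andP[iq _] lastE; rewrite lastE mem_last in iq.
- by move=> _ /= /andP[ip _] _ _ lastE; rewrite -lastE mem_last in ip.
move=> /= /andP[eix pp] /andP[ip up] /andP[eiy pq] /andP[iq uq] lastE.
have [xy | xy] := eqVneq x y.
  by rewrite -xy in pq uq lastE *; congr (_ :: _); apply: (IHp _ x).
pose w := p ++ rev (belast y q).
have pw : path e x w.
  by rewrite cat_path pp lastE rev_path_sym.
have wy : last x w = y.
  rewrite /w; case: (q) => [|z q'] in lastE *; first by rewrite cats0.
  by rewrite /= rev_cons last_cat last_rcons.
have iw : i \notin x :: w.
  rewrite /w -cat_cons mem_cat mem_rev negb_or ip.
  by apply: contra iq => /mem_belast.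
case/shortenP: pw wy => w' pw' uw' sw' w'y.
have : ucycle e [:: i, x & w'].
  rewrite /ucycle; apply/andP; split.
    by rewrite /= eix rcons_path pw' w'y e_sym eiy.
  rewrite cons_uniq uw' andbT; apply: contra iw.
  by rewrite !inE => /orP[->//|/sw' ->]; rewrite orbT.
move/(tree_acyclic tree_e); case: w' w'y {pw' uw' sw'} => //= yx.
by rewrite yx eqxx in xy.
Qed.

Lemma simple_pathP i j :
  [/\ path e i (simple_path e i j), last i (simple_path e i j) = j &
      uniq (i :: simple_path e i j)].
Proof.
rewrite /simple_path; case: pickP => [p /and3P[pp /eqP lp up] // | none].
have [_ /(_ i j (in_setT _) (in_setT _))] := tree_connected tree_e.
case/connectP=> p0 pp0 jE; case/shortenP: pp0 jE => p pp up _ jE.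
(* A duplicate-free path fits in [n.-bseq], so the search in [simple_path] never falls back on its
   default. *)
have sp : (size p <= n)%N.
  by have := max_card (mem (i :: p)); rewrite (card_uniqP up) card_ord => /ltnW.
have ep : path e i p.
  by apply: sub_path pp => u v /and3P[].
by have := none (Bseq sp); move: up; rewrite /= ep -jE eqxx /= => ->.
Qed.

Lemma simple_path_eq i j p :
  path e i p -> last i p = j -> uniq (i :: p) -> simple_path e i j = p.
Proof.
move=> pp lp up; have [ps ls us] := simple_pathP i j.
by apply: (uniq_path_inj ps us pp up); rewrite ls.
Qed.

Lemma simple_path_id i : simple_path e i i = [::].
Proof. exact: simple_path_eq. Qed.

Lemma simple_path_subset_walk i j p :
  path e i p -> last i p = j -> {subset i :: simple_path e i j <= i :: p}.
Proof.
move=> pp; case/shortenP: (pp) => q pq uq sq lq v.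
rewrite (simple_path_eq pq lq uq) !inE => /orP[-> // | /sq ->].
by rewrite orbT.
Qed.

Lemma simple_path_cons v u j p :
    e v u -> path e u p -> last u p = j -> v \notin u :: p ->
  simple_path e v j = u :: simple_path e u j.
Proof.
move=> evu pp lp vp; have [ps ls us] := simple_pathP u j.
apply: simple_path_eq; rewrite /= ?evu //.
apply/andP; split=> //.
by apply: contra vp; apply: simple_path_subset_walk.
Qed.

Lemma simple_path_rcons v u j p :
    e u v -> path e j p -> last j p = u -> v \notin j :: p ->
  simple_path e j v = rcons (simple_path e j u) v.
Proof.
move=> euv pp lp vp; have [ps ls us] := simple_pathP j u.
apply: simple_path_eq; rewrite ?rcons_path ?last_rcons ?ls ?ps //.
rewrite -rcons_cons rcons_uniq us andbT.
by apply: contra vp; apply: simple_path_subset_walk.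
Qed.

(** The working form of connectedness: in a tree it follows from [induced_connected], and it is
    stable under intersection. *)
Definition tree_convex C :=
  {in C &, forall u v, {subset u :: simple_path e u v <= C}}.

Lemma induced_connected_walk C u v : induced_connected e C ->
  u \in C -> v \in C ->
  exists p, [/\ path e u p, last u p = v & {subset u :: p <= C}].
Proof.
move=> [_ connC] Cu Cv; have /connectP[p pp ->] := connC _ _ Cu Cv.
exists p; split=> //; first by apply: sub_path pp => x y /and3P[].
elim: p u Cu pp => [|x p IHp] u Cu /=; first by move=> _ y; rewrite inE => /eqP->.
case/andP=> /and3P[_ Cx _] pp y; rewrite inE => /orP[/eqP-> //|].
exact: IHp.
Qed.

Lemma induced_connected_convex C : induced_connected e C -> tree_convex C.
Proof.
move=> connC u v Cu Cv; have [p [pp lp sp]] := induced_connected_walk connC Cu Cv.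
by move=> y /(simple_path_subset_walk pp lp)/sp.
Qed.

Lemma tree_convexI C W : tree_convex C -> tree_convex W -> tree_convex (C :&: W).
Proof.
move=> cC cW u v /setIP[Cu Wu] /setIP[Cv Wv] y yp.
by rewrite inE (cC u v) // (cW u v).
Qed.

Lemma convex_simple_path_cons C v u j : tree_convex C ->
  e v u -> v \notin C -> u \in C -> j \in C ->
  simple_path e v j = u :: simple_path e u j.
Proof.
move=> cC evu Cv Cu Cj; have [pp lp _] := simple_pathP u j.
by apply: (simple_path_cons evu pp lp); apply: contra Cv => /(cC _ _ Cu Cj).
Qed.

Lemma convex_simple_path_rcons C v u j : tree_convex C ->
  e v u -> v \notin C -> u \in C -> j \in C ->
  simple_path e j v = rcons (simple_path e j u) v.
Proof.
move=> cC evu Cv Cu Cj; have [pp lp _] := simple_pathP j u.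
have euv : e u v by rewrite e_sym.
by apply: (simple_path_rcons euv pp lp); apply: contra Cv => /(cC _ _ Cj Cu).
Qed.

(** Since [W :\ w] is convex, the path from [w] to [r] starts with any given neighbour of [w] in
    [W]; paths being unique, there is only one neighbour. Convexity of [W] supplies it as the first
    step towards [r]. *)
Lemma convex_leaf_neighbour W w r : tree_convex W -> tree_convex (W :\ w) ->
    w \in W -> r \in W :\ w ->
  exists2 p, neighbours_in e W w = [set p] & e w p /\ p \in W :\ w.
Proof.
move=> cW cWw Ww Wr; have [rw Wr'] := setD1P Wr.
have [pp lp up] := simple_pathP w r; have := cW _ _ Ww Wr'.
case: simple_path => [|p q] in pp lp up *; first by rewrite -lp eqxx in rw.
move=> sW; case/andP: pp => ewp _.
have Wp : p \in W :\ w.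
  rewrite !inE sW ?inE ?eqxx ?orbT // andbT eq_sym.
  by case/andP: up; rewrite inE negb_or => /andP[].
exists p => //; apply/setP=> u; rewrite !inE.
apply/andP/eqP => [[Wu ewu] | ->]; last by split=> //; case/setD1P: Wp.
have Wu' : u \in W :\ w.
  by rewrite !inE Wu andbT; apply: contraTneq ewu => ->; rewrite (tree_irr tree_e).
have wW : w \notin W :\ w by rewrite !inE eqxx.
have := convex_simple_path_cons cWw ewp wW Wp Wr.
by rewrite (convex_simple_path_cons cWw ewu wW Wu' Wr) => -[].
Qed.

(* The vertex of [W] farthest from [u] is a leaf. *)
Lemma convex_leaf W u : tree_convex W -> u \in W -> (1 < #|W|)%N ->
  exists w, [/\ w \in W, w != u & tree_convex (W :\ w)].
Proof.
move=> cW Wu W_gt1.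
have [w Ww wmax] := arg_maxnP (fun v => size (simple_path e u v)) Wu.
have wu : w != u.
  apply: contraTneq W_gt1 => wu; rewrite -leqNgt -(cards1 u) subset_leq_card //.
  apply/subsetP=> v /wmax /=; rewrite wu simple_path_id inE leqn0 => /nilP vu.
  by have [_ <- _] := simple_pathP u v; rewrite vu.
(* A vertex [j] reached through [w] would lie farther from [u] than [w]. *)
have avoid j : j \in W :\ w -> w \notin u :: simple_path e u j.
  case/setD1P=> jw Wj; apply/negP=> wj.
  have [pp lp up] := simple_pathP u j.
  move: wj; rewrite inE (negPf wu) /= => wj.
  have [p1 [p2 def_p]] : exists p1 p2, simple_path e u j = p1 ++ w :: p2.
    by case/splitPr: wj => p1 p2; exists p1, p2.
  have := wmax _ Wj; move: pp lp up; rewrite def_p -cat_rcons => pp lp up.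
  have -> : simple_path e u w = rcons p1 w.
    apply: simple_path_eq; rewrite ?last_rcons //.
      by move: pp; rewrite cat_path => /andP[].
    by move: up; rewrite -cat_cons cat_uniq => /and3P[].
  rewrite /= size_cat -[leqRHS]addn0 leq_add2l leqn0 => /nilP p20.
  by rewrite p20 cats0 last_rcons in lp; rewrite lp eqxx in jw.
exists w; split=> // i j Wi Wj v vp.
have [[iw Wi'] [jw Wj']] := (setD1P Wi, setD1P Wj).
rewrite !inE (cW i j) // andbT; apply: contraTneq vp => -> {v}.
have [pi li _] := simple_pathP u i; have [pj lj _] := simple_pathP u j.
(* The walk from [i] to [u] and on to [j] misses [w], hence so does the simple path. *)
pose p := rev (belast u (simple_path e u i)) ++ simple_path e u j.
have lr : last i (rev (belast u (simple_path e u i))) = u.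
  by rewrite -{1}li; case: simple_path => //= x s; rewrite rev_cons last_rcons.
have pp : path e i p.
  by rewrite cat_path lr pj andbT -{1}li rev_path_sym.
apply/negP=> /(simple_path_subset_walk pp (_ : last i p = j)).
rewrite last_cat lr => /(_ lj); rewrite inE eq_sym (negPf iw) mem_cat mem_rev /=.
case/orP=> [/mem_belast|wj]; first by rewrite (negPf (avoid _ Wi)).
by have := avoid _ Wj; rewrite inE wj orbT.
Qed.

End Tree.

(** * Distance determinants of subtrees *)

Section PathWeight.

Variables (K : comNzRingType) (n : nat) (a m : 'I_n -> 'I_n -> K).

Fixpoint path_prod (i : 'I_n) (p : seq 'I_n) : K :=
  if p is j :: q then m i j * path_prod j q else 1.

Lemma path_weight_nil i : path_weight a m i [::] = 0.
Proof. by rewrite /path_weight big_ord0. Qed.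

Lemma path_weight_cons i j p :
  path_weight a m i (j :: p)
  = a i j * (m i j - 1) + m i j * path_weight a m j p.
Proof.
rewrite /path_weight /= big_ord_recl big_ord0 mulr1; congr (_ + _).
rewrite mulr_sumr; apply: eq_bigr => l _; rewrite big_ord_recl /= !add0n.
(* All positions are in range, so the two default vertices give the same entries. *)
have nthE k : (k <= l)%N -> nth i (j :: p) k = nth j (j :: p) k.
  by move=> kl; apply: set_nth_default; exact: leq_trans kl (ltnW (ltn_ord l)).
have nthE' k : (k <= l)%N -> nth i p k = nth j p k.
  by move=> kl; apply: set_nth_default; exact: leq_ltn_trans kl (ltn_ord l).
rewrite nthE // nthE' // mulrCA; congr (_ * (_ * _)).
apply: eq_bigr => u _; rewrite !add0n.
by rewrite nthE ?nthE' // ltnW.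
Qed.

(** The last edge is weighted by the product over the whole preceding path: column operations
    produce columns of path products where row operations produce constants. *)
Lemma path_weight_rcons i p j :
  path_weight a m i (rcons p j)
  = path_weight a m i p
    + a (last i p) j * (m (last i p) j - 1) * path_prod i p.
Proof.
elim: p i => [|k p IHp] i /=.
  by rewrite path_weight_cons !path_weight_nil mulr0 mulr1 addrC.
by rewrite !path_weight_cons IHp; ring.
Qed.

End PathWeight.

(** Applied to [polyC], this moves the distances into the polynomial ring, where the indeterminate
    is an ordinary scalar. *)
Lemma rmorph_path_weight (K L : comNzRingType) (h : {rmorphism K -> L}) (n : nat)
    (a m : 'I_n -> 'I_n -> K) i p :
  h (path_weight a m i p)
  = path_weight (fun u v => h (a u v)) (fun u v => h (m u v)) i p.
Proof.
elim: p i => [|j p IHp] i; first by rewrite !path_weight_nil rmorph0.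
by rewrite !path_weight_cons rmorphD !rmorphM rmorphB rmorph1 IHp.
Qed.

(** * Edge sets of subtrees under removal of a leaf *)

Section Edges.

Variables (n : nat) (e : rel 'I_n).
Hypothesis tree_e : is_tree e.

Lemma edges_in_leaf W w p : neighbours_in e W w = [set p] -> w \in W ->
  edges_in e W = edge w p |: edges_in e (W :\ w).
Proof.
move=> nbr Ww; have nbrE u : (u \in W) && e w u = (u == p).
  by have := in_set1 u p; rewrite -nbr inE.
have /andP[Wp ewp] : (p \in W) && e w p by rewrite nbrE.
have sym := tree_sym tree_e.
have wp : w != p by apply: contraTneq ewp => ->; rewrite (tree_irr tree_e).
apply/setP=> -[u v]; rewrite !inE /= /edge.
apply/idP/idP => [/and4P[uv euv Wu Wv] | ].
  rewrite uv euv Wu Wv !andbT /=.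
  have [uw | uw] := eqVneq u w.
    have /eqP-> : v == p by rewrite -nbrE Wv -uw.
    have -> : (w < p)%N; last by rewrite uw eqxx.
    by rewrite -uw; move: uv; have /eqP-> : v == p by rewrite -nbrE Wv -uw.
  have [vw | //] := eqVneq v w; last by rewrite orbT.
  have /eqP up : u == p by rewrite -nbrE Wu -vw sym.
  by rewrite -up -vw ltnNge (ltnW uv) /= eqxx.
case/orP=> [|/and5P[-> -> /andP[_ ->] _ ->] //].
case: ltnP => [lt_wp | le_pw] /eqP[-> ->]; first by rewrite lt_wp ewp Ww Wp.
by rewrite sym ewp Ww Wp !andbT ltn_neqAle le_pw andbT eq_sym; exact: wp.
Qed.

Lemma edge_notin_edges_in W w p : edge w p \notin edges_in e (W :\ w).
Proof. by rewrite /edge; case: ifP => _; rewrite !inE /= eqxx /= ?andbF. Qed.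

Lemma edges_in1 u : edges_in e [set u] = set0.
Proof.
apply/setP=> -[v w]; rewrite !inE /=; apply/negP=> /and4P[vw _ /eqP vu /eqP wu].
by rewrite vu wu ltnn in vw.
Qed.

End Edges.

(** * Bordered and principal determinants of a subtree *)

Section TreeDet.

Variables (K : comNzRingType) (n : nat) (e : rel 'I_n).
Variables (a m : 'I_n -> 'I_n -> K) (x : K).
Hypothesis tree_e : is_tree e.
Hypothesis a_sym : forall i j, e i j -> a i j = a j i.
Implicit Types (C W : {set 'I_n}).

(** Below, [sdist] is the [F] and [tprod] the [P] of the overview, with [x] an arbitrary scalar. *)
Definition tdist i j : K := path_weight a m i (simple_path e i j).
Definition tprod i j : K := path_prod m i (simple_path e i j).
Definition sdist i j : K := tdist i j + x.
Definition ecoef (f : 'I_n * 'I_n) : K :=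
  a f.1 f.2 * (1 - m f.1 f.2 * m f.2 f.1).

Lemma tdist_id i : tdist i i = 0.
Proof. by rewrite /tdist (simple_path_id tree_e) path_weight_nil. Qed.

Lemma tprod_id i : tprod i i = 1.
Proof. by rewrite /tprod (simple_path_id tree_e). Qed.

Lemma ecoef_edge w p : e w p -> ecoef (edge w p) = a w p * (1 - m w p * m p w).
Proof.
move=> ewp; rewrite /ecoef /edge; case: ifP => //= _.
by rewrite (a_sym ewp) (mulrC (m w p)).
Qed.

Lemma tdist_row v u j : simple_path e v j = u :: simple_path e u j ->
  tdist v j = a v u * (m v u - 1) + m v u * tdist u j.
Proof. by rewrite /tdist => ->; rewrite path_weight_cons. Qed.

Lemma tprod_row v u j : simple_path e v j = u :: simple_path e u j ->
  tprod v j = m v u * tprod u j.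
Proof. by rewrite /tprod => ->. Qed.

Lemma tdist_col C v u j : tree_convex e C -> e v u -> v \notin C ->
  u \in C -> j \in C ->
  tdist j v = tdist j u + a v u * (m u v - 1) * tprod j u.
Proof.
move=> cC evu Cv Cu Cj; rewrite /tdist (convex_simple_path_rcons tree_e cC evu) //.
by have [_ lp _] := simple_pathP tree_e j u; rewrite path_weight_rcons lp (a_sym evu).
Qed.

(** For [j != w] this is the first-step recursion. At [j = w] that recursion would measure the
    closed walk [w, p, w], and the [ecoef] term makes up for it. *)
Lemma sdist_leaf_row C w p j : tree_convex e (C :\ w) -> e w p ->
  p \in C :\ w -> j \in C ->
  sdist w j = m w p * sdist p j
              + ((a w p - x) * (m w p - 1) + ecoef (edge w p) * (w == j)%:R).
Proof.
move=> cC ewp Cp Cj; rewrite ecoef_edge // /sdist.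
have Cw : w \notin C :\ w by rewrite !inE eqxx.
have [<- | wj] := eqVneq w j.
  by rewrite (tdist_col cC ewp Cw Cp Cp) !tdist_id tprod_id /=; ring.
rewrite (@tdist_row w p) /=; first by ring.
by apply: (convex_simple_path_cons tree_e cC) => //; rewrite !inE eq_sym wj.
Qed.

(** A vertex [v] outside the subtree indexes the border, which keeps the bordered matrix within the
    scope of [set_det]. *)
Definition bordered (v q i j : 'I_n) : K :=
  if i == v then (j != v)%:R else if j == v then tprod i q else sdist i j.

(** The peeled leaf [w] must differ from [q]: the path from [w] to [q] then starts with [p], and the
    row operation also clears the border entry of row [w]. *)
Lemma bordered_det C v q : tree_convex e C -> v \notin C -> q \in C ->
  set_det (v |: C) (bordered v q) = - \prod_(f in edges_in e C) ecoef f.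
Proof.
have [k] := ubnP #|C|; elim: k C => // k IHk C leCk cC Cv Cq.
have vq : v != q by apply: contraNneq Cv => ->.
have [C_gt1 | C_le1] := ltnP 1 #|C|.
  have [w [Cw wq cCw]] := convex_leaf tree_e cC Cq C_gt1.
  have Cwq : q \in C :\ w by rewrite !inE eq_sym wq.
  have [p nbr [ewp Cwp]] := convex_leaf_neighbour tree_e cC cCw Cw Cwq.
  have [pw Cp] := setD1P Cwp.
  have wp : w != p by rewrite eq_sym.
  have wv : w != v by apply: contraNneq Cv => <-.
  have pv : p != v by apply: contraNneq Cv => <-.
  have Ww : w \in v |: C by rewrite !inE Cw orbT.
  have Wv : v \in v |: C by rewrite !inE eqxx.
  have Wp : p \in v |: C by rewrite !inE Cp orbT.
  have nwCw : w \notin C :\ w by rewrite !inE eqxx.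
  rewrite (edges_in_leaf tree_e nbr Cw) big_setU1 ?edge_notin_edges_in //=.
  pose g j := (a w p - x) * (m w p - 1) * (j != v)%:R
              + ecoef (edge w p) * (w == j)%:R.
  rewrite (@set_det_row_op _ _ _ _ w p (m w p) 1 g) //; last first.
    move=> j; rewrite !inE /bordered (negPf wv) (negPf pv) mul1r /g.
    have [-> _ | jv /= Cj] := eqVneq j v.
      rewrite (negPf wv) (@tprod_row w p) ?mulr0 ?addr0 //.
      exact: (convex_simple_path_cons tree_e cCw).
    by rewrite mulr1; apply: sdist_leaf_row Cj.
  (* The border row, equal to one on [C], absorbs the constant part of [g]. *)
  rewrite (@set_det_row_op _ _ _ _ w v ((a w p - x) * (m w p - 1))
             (ecoef (edge w p)) (fun j => (w == j)%:R)) //; last first.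
    by move=> j _; rewrite /row_upd eqxx eq_sym (negPf wv) /bordered eqxx.
  rewrite mul1r -mulrN (set_det_row_unit Ww); last first.
    by move=> j _; rewrite /row_upd eqxx.
  have -> : (v |: C) :\ w = v |: (C :\ w).
    by apply/setP=> j; rewrite !inE; case: (eqVneq j v) => // ->; rewrite eq_sym wv.
  congr (_ * _); rewrite -IHk //.
  - apply: eq_set_det => i j iW _; rewrite /row_upd.
    suff /negPf-> : i != w by [].
    by apply: contraTneq iW => ->; rewrite !inE eqxx (negPf wv).
  - by move: leCk; rewrite (cardsD1 w C) Cw.
  - by rewrite !inE (negPf Cv) andbF.
have {C_le1}C1 : C = [set q].
  apply/eqP; rewrite eq_sym eqEcard sub1set Cq cards1 //.
rewrite C1 edges_in1 big_set0.
have qv : q != v by rewrite eq_sym.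
have Wq : q \in [set v; q] by rewrite !inE eqxx orbT.
have Wv : v \in [set v; q] by rewrite !inE eqxx.
(* In the order [q], [v] the matrix has rows $(x, 1)$ and $(1, 0)$; once $x$ is cleared, a column
   swap gives the identity. *)
rewrite (@set_det_row_op _ _ _ _ q v x 1 (fun j => (v == j)%:R)) //; last first.
  move=> j; rewrite !inE /bordered eqxx (negPf qv) mul1r.
  case/orP=> /eqP->; rewrite ?eqxx ?mulr0 ?add0r ?tprod_id //.
  by rewrite (negPf qv) (negPf vq) /sdist tdist_id mulr1 add0r addr0.
rewrite mul1r -[LHS]opprK -(set_det_tperm _ vq Wv Wq); congr (- _).
rewrite (set_det_row_unit Wq) => [|j]; last first.
  rewrite !inE /row_upd eqxx => /orP[]/eqP->; rewrite ?tpermL ?tpermR ?eqxx //.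
  by rewrite (negPf vq) eq_sym (negPf vq).
have -> : [set v; q] :\ q = [set v].
  apply/setP=> j; rewrite !inE; case: (eqVneq j q) => [->|_];
    by rewrite /= ?orbF ?(negPf qv).
rewrite (set_det_row_unit (set11 v)) => [|j]; last first.
  rewrite inE /row_upd (negPf vq) /bordered eqxx => /eqP->.
  by rewrite tpermL eq_sym vq eqxx.
by rewrite setDv set_det0.
Qed.

(** The reduced row of a leaf [w] splits in two. Its diagonal part leads to the determinant on
    [W :\ w]; its constant part leads, after a column operation, to the bordered determinant and
    yields the summand of the edge at [w]. *)
Lemma convex_det W : W != set0 -> tree_convex e W ->
  set_det W sdist
  = x * \prod_(f in edges_in e W) ecoef f
    - \sum_(f in edges_in e W)
        a f.1 f.2 * (a f.1 f.2 - x) * (m f.1 f.2 - 1) * (m f.2 f.1 - 1)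
        * \prod_(g in edges_in e W :\ f) ecoef g.
Proof.
have [k] := ubnP #|W|; elim: k W => // k IHk W leWk /set0Pn[q Wq] cW.
have [W_gt1 | W_le1] := ltnP 1 #|W|; last first.
  have -> : W = [set q] by apply/eqP; rewrite eq_sym eqEcard sub1set Wq cards1.
  rewrite edges_in1 !big_set0 mulr1 subr0.
  rewrite (@set_det_row_lin _ _ _ _ q x 0 (fun j => (q == j)%:R) (fun=> 0)) ?set11 //.
    rewrite mul0r addr0 (set_det_row_unit (set11 q)) ?setDv ?set_det0 ?mulr1 //.
    by move=> j _; rewrite /row_upd eqxx.
  by move=> j /set1P->; rewrite /sdist tdist_id eqxx mulr1 mul0r addr0 add0r.
have [w [Ww wq cWw]] := convex_leaf tree_e cW Wq W_gt1.
have Wwq : q \in W :\ w by rewrite !inE eq_sym wq.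
have [p nbr [ewp Wwp]] := convex_leaf_neighbour tree_e cW cWw Ww Wwq.
have [pw Wp] := setD1P Wwp.
have nwWw : w \notin W :\ w by rewrite !inE eqxx.
have wp : w != p by rewrite eq_sym.
set E' := edges_in e (W :\ w).
have nE' : edge w p \notin E' by apply: edge_notin_edges_in.
have wWE : w |: (W :\ w) = W by rewrite setD1K.
have EE : edges_in e W = edge w p |: E' by apply: edges_in_leaf.
rewrite EE !big_setU1 //= setU1K //.
transitivity (ecoef (edge w p) * set_det (W :\ w) sdist
  - a w p * (a w p - x) * (m w p - 1) * (m p w - 1) * \prod_(g in E') ecoef g).
  rewrite (@set_det_row_op _ _ _ _ w p (m w p) 1
     (fun j => (a w p - x) * (m w p - 1) * 1 + ecoef (edge w p) * (w == j)%:R)) //.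
    rewrite mul1r (@set_det_row_lin _ _ _ _ w ((a w p - x) * (m w p - 1))
      (ecoef (edge w p)) (fun=> 1) (fun j => (w == j)%:R)) //; last first.
      by move=> j _; rewrite /row_upd eqxx.
    rewrite addrC; congr (_ + _).
      congr (_ * _); rewrite (set_det_row_unit Ww); last first.
        by move=> j _; rewrite /row_upd eqxx.
      apply: eq_set_det => i j iW _; rewrite /row_upd.
      by case: eqP iW => // ->; rewrite !inE eqxx.
    set F := row_upd _ _ _.
    (* Row [w] of [F] is constant, so subtracting column [p] leaves a zero in the corner, and [w]
       becomes the border index of [W :\ w]. *)
    rewrite (@set_det_col_op _ _ _ F w p 1 (a w p * (m p w - 1))
       (fun i => if i == w then 0 else tprod i p)) //; last first.
      move=> i Wi; rewrite /F /row_upd; case: eqVneq => [_|iw]; first by ring.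
      rewrite /sdist (tdist_col cWw ewp) //; first by ring.
      by rewrite !inE iw.
    rewrite (_ : set_det W _ = - \prod_(g in E') ecoef g); first by ring.
    rewrite -(bordered_det cWw nwWw Wwp) wWE; apply: eq_set_det => i j _ _.
    by rewrite /bordered /col_upd /F /row_upd; case: eqP => _; case: eqP.
  by move=> j Wj; rewrite mul1r mulr1; apply: sdist_leaf_row Wj.
rewrite IHk //; first last.
- by apply/set0Pn; exists q.
- by move: leWk; rewrite (cardsD1 w W) Ww.
rewrite -/E' mulrBr mulr_sumr mulrCA -addrA -opprD; congr (_ - _).
rewrite addrC; congr (_ + _); last first.
  by rewrite /edge; case: ifP => //= _; rewrite (a_sym ewp); ring.
apply: eq_bigr => f E'f; have fw : edge w p != f by apply: contraNneq nE' => ->.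
have -> : (edge w p |: E') :\ f = edge w p |: (E' :\ f).
  apply/setP=> g; rewrite !inE; case: (eqVneq g f) => //= ->.
  by rewrite eq_sym (negPf fw).
have nf : edge w p \notin E' :\ f by rewrite inE (negPf nE') andbF.
by rewrite big_setU1 //=; ring.
Qed.

End TreeDet.

(** * Minors whose row and column sets differ *)

Section TreeMinors.

Variables (K : comNzRingType) (n : nat) (e : rel 'I_n).
Variables (a m : 'I_n -> 'I_n -> K) (x : K).
Hypothesis tree_e : is_tree e.
Hypothesis a_sym : forall i j, e i j -> a i j = a j i.
Implicit Types (C W S : {set 'I_n}).

(** Each peeled leaf takes one edge with it. The count settles the sign when the factors $1 - m m'$
    become $m m' - 1$ in case (ii). *)
Lemma card_edges_in C : C != set0 -> tree_convex e C -> #|edges_in e C|.+1 = #|C|.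
Proof.
have [k] := ubnP #|C|; elim: k C => // k IHk C leCk /set0Pn[q Cq] cC.
have [C_gt1 | C_le1] := ltnP 1 #|C|; last first.
  have -> : C = [set q] by apply/eqP; rewrite eq_sym eqEcard sub1set Cq cards1.
  by rewrite edges_in1 cards0 cards1.
have [w [Cw wq cCw]] := convex_leaf tree_e cC Cq C_gt1.
have Cwq : q \in C :\ w by rewrite !inE eq_sym wq.
have [p nbr _] := convex_leaf_neighbour tree_e cC cCw Cw Cwq.
rewrite (edges_in_leaf tree_e nbr Cw) cardsU1 edge_notin_edges_in.
rewrite (cardsD1 w C) Cw in leCk *; rewrite add1n IHk //.
by apply/set0Pn; exists q.
Qed.

Lemma edgeC (u v : 'I_n) : edge u v = edge v u.
Proof.
rewrite /edge; case: (ltngtP u v) => // uv.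
by rewrite (val_inj uv).
Qed.

(** Column [j0] is deleted, and the transposition lets the index [j0] stand for column [i0] instead.
    Row [j0] and this column then reduce to a border of [W :\ i0 :\ j0]. *)
Lemma convex_minor_det W i0 j0 p q :
    tree_convex e (W :\ i0) -> tree_convex e (W :\ j0) ->
    tree_convex e (W :\ i0 :\ j0) ->
    i0 != j0 -> i0 \in W -> j0 \in W -> e i0 p -> p \in W :\ i0 :\ j0 ->
    e j0 q -> q \in W :\ i0 :\ j0 ->
  set_det (W :\ i0) (fun i j => sdist e a m x i (tperm i0 j0 j))
  = - (\prod_(f in edges_in e (W :\ i0 :\ j0)) ecoef a m f
       * a p i0 * (a j0 q - x) * (m p i0 - 1) * (m j0 q - 1)).
Proof.
move=> cWi cWj cC ij Wi Wj eip Cp ejq Cq.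
have [pj Wip] := setD1P Cp; have [pi Wp] := setD1P Wip.
have [qj Wiq] := setD1P Cq; have [qi Wq] := setD1P Wiq.
have Wij : j0 \in W :\ i0 by rewrite !inE eq_sym ij.
have jC : j0 \notin W :\ i0 :\ j0 by rewrite !inE eqxx.
have iWi : i0 \notin W :\ i0 by rewrite !inE eqxx.
have jq : j0 != q by rewrite eq_sym.
have jp : j0 != p by rewrite eq_sym.
have Wjq : q \in W :\ j0 by rewrite !inE qj.
rewrite (@set_det_row_op _ _ _ _ j0 q (m j0 q) ((a j0 q - x) * (m j0 q - 1))
           (fun=> 1)) //; last first.
  move=> j /setD1P[ji Wj'].
  rewrite (sdist_leaf_row m x tree_e a_sym cWj ejq Wjq); last first.
    by case: tpermP => // ji'; rewrite ji' eqxx in ji.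
  (* Column [j0] is absent from the minor, so row [j0] receives no diagonal term. *)
  suff /negPf-> : j0 != tperm i0 j0 j by rewrite mulr0 addr0 mulr1.
  by rewrite eq_sym -{2}(tpermL i0 j0) (inj_eq perm_inj).
set F := row_upd _ _ _.
rewrite (@set_det_col_op _ _ _ F j0 p 1 (a i0 p * (m p i0 - 1))
       (fun i => if i == j0 then 0 else tprod e m i p)) //; last first.
  move=> i Wi'; rewrite /F /row_upd tpermR; case: eqVneq => [_|_]; first by ring.
  rewrite tpermD 1?eq_sym // /sdist.
  by rewrite (tdist_col m tree_e a_sym cWi eip iWi Wip Wi'); ring.
have -> : set_det (W :\ i0) (col_upd F j0
    (fun i => if i == j0 then 0 else tprod e m i p))
  = - \prod_(f in edges_in e (W :\ i0 :\ j0)) ecoef a m f.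
  rewrite -(bordered_det m x tree_e a_sym cC jC Cp) (setD1K Wij).
  apply: eq_set_det => i j /setD1P[ii _] /setD1P[ji _].
  rewrite /bordered /col_upd /F /row_upd.
  case: eqVneq => [_|ij']; case: eqVneq => // jj.
  by rewrite tpermD // eq_sym.
by rewrite (a_sym eip); ring.
Qed.

(** Following the path from [b] to [r] and then going to [j] inside [S] never returns to [b], so all
    paths from [b] into [S] share their first edge. *)
Lemma exterior_first_step S b r : tree_convex e S -> b \notin S -> r \in S ->
  exists u, [/\ e b u, u \in simple_path e b r &
    {in S, forall j, simple_path e b j = u :: simple_path e u j}].
Proof.
move=> cS Sb Sr; have [pp lp up] := simple_pathP tree_e b r.
case def_p: (simple_path e b r) => [|u p] in pp lp up *.
  by rewrite -lp /= (negPf Sb) in Sr.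
rewrite /= in pp lp up; case/andP: pp => ebu pp.
exists u; split; rewrite ?mem_head // => j Sj.
have [pj lj _] := simple_pathP tree_e r j.
apply: (@simple_path_cons _ _ tree_e _ _ _ (p ++ simple_path e r j)) => //.
- by rewrite cat_path pp lp.
- by rewrite last_cat lp.
rewrite -cat_cons mem_cat negb_or; case/andP: up => -> _ /=.
by apply: contra Sb => bj; apply: (cS r j) => //; rewrite inE bj orbT.
Qed.

(** Rows [b1] and [b2] become constant once multiples of the rows of their first steps [u1] and [u2]
    are subtracted; these lie in [W] by convexity. *)
Lemma convex_minor_det0 W S (g : 'I_n -> 'I_n) b1 b2 r :
    tree_convex e W -> tree_convex e S -> {in W, forall j, g j \in S} ->
    b1 != b2 -> b1 \in W :\: S -> b2 \in W :\: S -> r \in W :&: S ->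
  set_det W (fun i j => sdist e a m x i (g j)) = 0.
Proof.
move=> cW cS gS b12 /setDP[Wb1 Sb1] /setDP[Wb2 Sb2] /setIP[Wr Sr].
have [u1 [e1 p1 step1]] := exterior_first_step cS Sb1 Sr.
have [u2 [e2 p2 step2]] := exterior_first_step cS Sb2 Sr.
have Wu1 : u1 \in W by apply: (cW _ _ Wb1 Wr); rewrite inE p1 orbT.
have Wu2 : u2 \in W by apply: (cW _ _ Wb2 Wr); rewrite inE p2 orbT.
(* The second operation uses row [u2] in its original form, hence [u2 != b1]. By symmetry only
   [u2 = b1] together with [u1 = b2] could obstruct, and the path lengths to [r] exclude that. *)
wlog u2b1 : b1 b2 u1 u2 b12 Wb1 Sb1 Wb2 Sb2 e1 p1 step1 e2 p2 step2 Wu1 Wu2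
    / u2 != b1.
  move=> hwlog; have [u2b1 | u2b1] := eqVneq u2 b1; last first.
    exact: (hwlog b1 b2 u1 u2).
  have [u1b2 | u1b2] := eqVneq u1 b2; last first.
    by apply: (hwlog b2 b1 u2 u1); rewrite // eq_sym.
  have := congr1 size (step1 _ Sr); rewrite u1b2 (step2 _ Sr) u2b1 /=.
  by move/eqP; rewrite -addn2 -{1}[size _]addn0 eqn_add2l.
have rowE b u j : {in S, forall j, simple_path e b j = u :: simple_path e u j} ->
    j \in W -> sdist e a m x b (g j)
    = m b u * sdist e a m x u (g j) + (a b u - x) * (m b u - 1) * 1.
  by move=> step Wj; rewrite /sdist (tdist_row _ _ (step _ (gS _ Wj))); ring.
have neq b u : e b u -> b != u.
  by move=> ebu; apply: contraTneq ebu => ->; rewrite (tree_irr tree_e).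
rewrite (@set_det_row_op _ _ _ _ b1 u1 (m b1 u1) ((a b1 u1 - x) * (m b1 u1 - 1))
           (fun=> 1)) ?neq //; last by move=> j; apply: rowE.
set F := row_upd _ _ _.
rewrite (@set_det_row_op _ _ _ F b2 u2 (m b2 u2) ((a b2 u2 - x) * (m b2 u2 - 1))
           (fun=> 1)) ?neq //; last first.
  move=> j Wj; rewrite /F /row_upd [b2 == _]eq_sym (negPf b12) (negPf u2b1).
  exact: rowE.
rewrite (set_det_row_alt (r := b1) (s := b2)) ?mulr0 // => j _.
by rewrite /F /row_upd !eqxx (negPf b12).
Qed.

End TreeMinors.

(** * From deleted matrices to determinants on index sets *)

Section DeletedMinor.

Variables (K : comNzRingType) (n : nat).
Implicit Types (I J W : {set 'I_n}) (M : 'M[K]_n).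

(** Since [bump] is the index map of [lift], removal from an enumeration matches deletion of a row
    or column in a cofactor. *)
Lemma nth_rem (T : eqType) (z y : T) (s : seq T) i :
  nth z (rem y s) i = nth z s (bump (index y s) i).
Proof.
elim: s i => [|t s IHs] i /=; first by rewrite !nth_nil.
case: eqP => _ //=.
by case: i => [|i] //=; rewrite IHs /bump ltnS addnS.
Qed.

Lemma enum_setD1 W v : enum (W :\ v) = rem v (enum W).
Proof.
rewrite rem_filter ?enum_uniq // /enum_mem -filter_predI.
by apply: eq_filter => u; rewrite /= !inE.
Qed.

(** The enumeration is increasing, so a position counts the smaller elements; this makes the
    cofactor sign explicit. *)
Lemma index_enum_set W v : v \in W ->
  index v (enum W) = #|[set u in W | (u < v)%N]|.
Proof.
move=> Wv; have -> : #|[set u in W | (u < v)%N]|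
    = count (fun u : 'I_n => (u < v)%N) (enum W).
  rewrite cardE -size_filter; congr size; rewrite /enum_mem -filter_predI.
  by apply: eq_filter => u; rewrite /= !inE andbC.
have : sorted (relpre val ltn) (enum W).
  rewrite /enum_mem sorted_filter //; first by move=> u t w; apply: ltn_trans.
  by rewrite -enumT -sorted_map val_enum_ord iota_ltn_sorted.
rewrite -mem_enum in Wv; elim: (enum W) Wv => //= u s IHs.
rewrite inE => vus srt.
have /allP min_u : all (relpre val ltn u) s.
  by apply: order_path_min srt => t w y; apply: ltn_trans.
case: eqVneq vus => [-> _ | _ /= vs].
  rewrite ltnn add0n; apply/esym/eqP; rewrite -leqn0 leqNgt -has_count.
  by apply/hasPn=> t /min_u /= /ltnW; rewrite -leqNgt.
by have /= -> := min_u v vs; rewrite IHs ?(path_sorted srt).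
Qed.

Lemma det_deleted_set M I J (eqIJ : #|I| = #|J|) : I = J ->
  \det (deleted_mx M eqIJ) = set_det (~: I) (fun i j => M i j).
Proof.
move=> IJ; subst J; have -> : deleted_mx M eqIJ
    = \matrix_(r, c) M (enum_val (A := mem (~: I)) r) (enum_val c).
  apply/matrixP=> r c; rewrite !mxE; congr (M _ (enum_val _)).
  exact: val_inj.
rewrite (set_det_inj (fun i j => M i j) (@enum_val_inj _ _)); congr set_det.
apply/setP=> v; rewrite in_set; apply/codomP/idP => [[r ->]|Iv].
  exact: enum_valP.
by exists (enum_rank_in Iv v); rewrite enum_rankK_in.
Qed.

(** Meant for the vanishing case, where it suffices that the columns come from [~: J]. The vertex
    [r] makes [enum_rank_in] available. *)
Lemma det_deleted_reindex M I J (eqIJ : #|I| = #|J|) r : r \in ~: I ->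
  exists2 g : 'I_n -> 'I_n, {in ~: I, forall j, g j \in ~: J} &
    \det (deleted_mx M eqIJ) = set_det (~: I) (fun i j => M i (g j)).
Proof.
move=> Ir; pose g j := enum_val (cast_ord (eq_card_setC eqIJ) (enum_rank_in Ir j)).
exists g => [j _|]; first exact: enum_valP.
have -> : deleted_mx M eqIJ
    = \matrix_(i, j) M (enum_val (A := mem (~: I)) i) (g (enum_val j)).
  by apply/matrixP=> i j; rewrite !mxE /g enum_valK_in.
rewrite (set_det_inj (fun i j => M i (g j)) (@enum_val_inj _ _)); congr set_det.
apply/setP=> v; rewrite in_set; apply/codomP/idP => [[i ->]|Iv].
  exact: enum_valP.
by exists (enum_rank_in Iv v); rewrite enum_rankK_in.
Qed.

(* The minor is the cofactor at [(i0, j0)] of the principal submatrix on [W],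
   i.e. the determinant of the latter with row [i0] replaced by the unit row
   at [j0]; exchanging the columns [i0] and [j0] costs one more sign. *)
Lemma det_deleted_cofactor M W I J (eqIJ : #|I| = #|J|) i0 j0 :
    ~: I = W :\ i0 -> ~: J = W :\ j0 -> i0 != j0 -> i0 \in W -> j0 \in W ->
  \det (deleted_mx M eqIJ)
  = (-1) ^+ (index i0 (enum W) + index j0 (enum W)).+1
    * set_det (W :\ i0) (fun i j => M i (tperm i0 j0 j)).
Proof.
move=> defI defJ ij Wi Wj.
have eI : enum (~: I) = rem i0 (enum W) by rewrite defI enum_setD1.
have eJ : enum (~: J) = rem j0 (enum W) by rewrite defJ enum_setD1.
have sW : size (enum W) = #|~: I|.+1 by rewrite defI -cardE (cardsD1 i0 W) Wi.
have ri : (index i0 (enum W) < #|~: I|.+1)%N by rewrite -sW index_mem mem_enum.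
have rj : (index j0 (enum W) < #|~: I|.+1)%N by rewrite -sW index_mem mem_enum.
(* This lists [W] in increasing order, so deleting one position leaves the order used by
   [deleted_mx]. *)
pose f (r : 'I_#|~: I|.+1) := nth i0 (enum W) r.
have injf : injective f.
  by move=> r s /eqP; rewrite nth_uniq ?enum_uniq ?sW // => /eqP/val_inj.
have codomf : [set v in codom f] = W.
  apply/setP=> v; rewrite in_set; apply/codomP/idP => [[r ->]|Wv].
    by rewrite -mem_enum mem_nth // sW.
  have rv : (index v (enum W) < #|~: I|.+1)%N by rewrite -sW index_mem mem_enum.
  by exists (Ordinal rv); rewrite /f nth_index // mem_enum.
pose F := row_upd (fun i j => M i j) i0 (fun j => (j0 == j)%:R).
have fi : f (Ordinal ri) = i0 by rewrite /f nth_index ?mem_enum.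
have fj : f (Ordinal rj) = j0 by rewrite /f nth_index ?mem_enum.
have minorE : \det (deleted_mx M eqIJ)
    = (-1) ^+ (index i0 (enum W) + index j0 (enum W)) * set_det W F.
  have -> : set_det W F = set_det [set v in codom f] F by rewrite codomf.
  rewrite -set_det_inj // (expand_det_row _ (Ordinal ri)).
  rewrite (bigD1 (Ordinal rj)) //= big1 ?addr0 => [|c cj].
    rewrite mxE fi fj /F /row_upd !eqxx mul1r /cofactor /=.
    rewrite mulrA -expr2 sqrr_sign mul1r.
    congr (\det _); apply/matrixP=> r c; rewrite !mxE.
    rewrite eq_sym -{1}fi (inj_eq injf) (negPf (neq_lift _ _)).
    rewrite !(enum_val_nth i0) /f /= eI eJ.
    by rewrite !nth_rem.
  rewrite mxE fi /F /row_upd eqxx -{1}fj (inj_eq injf) eq_sym (negPf cj).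
  by rewrite mul0r.
rewrite minorE exprS -mulrA mulrCA; congr (_ * _).
rewrite mulN1r -[LHS]opprK -(set_det_tperm F ij Wi Wj) (set_det_row_unit Wi).
  congr (- _); apply: eq_set_det => i j /setD1P[/negPf ii _] _.
  by rewrite /F /row_upd ii.
by move=> j _; rewrite /F /row_upd eqxx -{1}(tpermL i0 j0) (inj_eq perm_inj).
Qed.

End DeletedMinor.

(** * The three cases, by the size of the symmetric difference *)

Theorem theoremA (R : comNzRingType) (n : nat) (e : rel 'I_n)
  (a m : 'I_n -> 'I_n -> R) (I J' : {set 'I_n})
  (tree_e : is_tree e)
  (a_sym : forall i j : 'I_n, e i j -> a i j = a j i)
  (card_IJ : #|I| = #|J'|)
  (card_I : (#|I| + 3 <= n)%N)
  (IJ_proper : I :|: J' \proper [set: 'I_n])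
  (conn_I : induced_connected e (~: I))
  (conn_J : induced_connected e (~: J'))
  (conn_IJ : induced_connected e (~: (I :&: J'))) :
  let W := ~: (I :&: J') in
  let E0 := edges_in e W in
  let x : {poly R} := 'X in
  let A := fun f : 'I_n * 'I_n => (a f.1 f.2)%:P in
  let M := fun f : 'I_n * 'I_n => (m f.1 f.2)%:P in
  let M' := fun f : 'I_n * 'I_n => (m f.2 f.1)%:P in
  let d := \det (deleted_mx (shifted_distance_mx e a m) card_IJ) in
  [/\ #|symdiff I J'| = 0%N ->
        d = x * \prod_(f in E0) (A f * (1 - M f * M' f))
            - \sum_(f in E0) A f * (A f - x) * (M f - 1) * (M' f - 1)
                * \prod_(g in E0 :\ f) (A g * (1 - M g * M' g)),
      #|symdiff I J'| = 2%N ->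
        exists i0 j0 pi0 pj0 : 'I_n,
          [/\ I :\: J' = [set i0],
              J' :\: I = [set j0],
              neighbours_in e W i0 = [set pi0],
              neighbours_in e W j0 = [set pj0] &
              d = (-1) ^+ (#|[set v in W | (v < i0)%N]|
                           + #|[set v in W | (j0 < v)%N]|)
                  * (\prod_(f in E0 :\: [set edge pi0 i0; edge j0 pj0])
                       (A f * (M f * M' f - 1))
                     * (a pi0 i0)%:P * ((a j0 pj0)%:P - x)
                     * ((m pi0 i0)%:P - 1) * ((m j0 pj0)%:P - 1))]
    & (2 < #|symdiff I J'|)%N -> d = 0].
Proof.
move=> W E0 x A M M' d.
pose aP u v := (a u v)%:P; pose mP u v := (m u v)%:P.
have aP_sym i j : e i j -> aP i j = aP j i by move=> eij; rewrite /aP a_sym.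
have entryE : (fun i j => shifted_distance_mx e a m i j) =2 sdist e aP mP x.
  move=> i j; rewrite !mxE mulr1 /sdist /tdist; congr (_ + _).
  exact: (rmorph_path_weight (@polyC R)).
have [cI cJ cW] := And3 (induced_connected_convex tree_e conn_I)
  (induced_connected_convex tree_e conn_J) (induced_connected_convex tree_e conn_IJ).
have [r Ir Jr] : exists2 r, r \in ~: I & r \in ~: J'.
  case/properP: IJ_proper => _ [r _]; rewrite inE negb_or => /andP[rI rJ].
  by exists r; rewrite inE.
have cardD : #|I :\: J'| = #|J' :\: I|.
  by apply/eqP; rewrite -(eqn_add2l #|I :&: J'|) cardsID setIC cardsID card_IJ.
have cardS : #|symdiff I J'| = (#|J' :\: I| + #|J' :\: I|)%N.
  rewrite /symdiff cardsU cardD; have -> : (I :\: J') :&: (J' :\: I) = set0.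
    by apply/setP=> v; rewrite !inE; case: (v \in I); rewrite ?andbF.
  by rewrite cards0 subn0.
split=> [S0 | S2 | S_gt2].
- have /eqP : #|J' :\: I| == 0%N by rewrite -double_eq0 -addnn -cardS S0.
  move=> D0; have sJI : J' \subset I by rewrite -setD_eq0 -cards_eq0 D0.
  have IJ : I = J' by apply/esym/eqP; rewrite eqEcard sJI card_IJ leqnn.
  rewrite /d (det_deleted_set _ _ IJ) /E0 /W -IJ setIid.
  rewrite (eq_set_det (G := sdist e aP mP x)) => [|i j _ _].
    by apply: convex_det => //; case: conn_I.
  exact: entryE.
- have D1 : #|J' :\: I| = 1%N by apply: double_inj; rewrite -addnn -cardS S2.
  have /eqP/cards1P[j0 DJ] := D1.
  have /cards1P[i0 DI] : #|I :\: J'| == 1%N by rewrite cardD D1.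
  have /setDP[Ii Ji] : i0 \in I :\: J' by rewrite DI set11.
  have /setDP[Jj Ij] : j0 \in J' :\: I by rewrite DJ set11.
  have defI : ~: I = W :\ i0.
    apply/setP=> v; rewrite !inE; have := in_set1 v i0; rewrite -DI inE => <-.
    by case: (v \in I); case: (v \in J').
  have defJ : ~: J' = W :\ j0.
    apply/setP=> v; rewrite !inE; have := in_set1 v j0; rewrite -DJ inE => <-.
    by case: (v \in I); case: (v \in J').
  have ij : i0 != j0 by apply: contraNneq Ij => <-.
  have Wi : i0 \in W by rewrite !inE (negPf Ji) andbF.
  have Wj : j0 \in W by rewrite !inE (negPf Ij).
  have WC : W :\ i0 :\ j0 = W :\ j0 :\ i0 by rewrite !setDDl setUC.
  have cC : tree_convex e (W :\ i0 :\ j0).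
    suff -> : W :\ i0 :\ j0 = ~: I :&: ~: J' by apply: tree_convexI.
    rewrite defI defJ; apply/setP=> v; rewrite !inE.
    by case: (v == i0); case: (v == j0); case: (v \in I); case: (v \in J').
  have Cr : r \in W :\ i0 :\ j0.
    by move: Ir Jr; rewrite defI defJ !inE => /andP[-> ->] /andP[->].
  rewrite defI in cI Ir; rewrite defJ in cJ Jr.
  have [p nbr_i [eip _]] := convex_leaf_neighbour tree_e cW cI Wi Ir.
  have [q nbr_j [ejq _]] := convex_leaf_neighbour tree_e cW cJ Wj Jr.
  have Wji : i0 \in W :\ j0 by rewrite in_setD1 ij.
  have Wij : j0 \in W :\ i0 by rewrite in_setD1 eq_sym ij.
  (* Here [p != j0]: [i0] is also a leaf of [W :\ j0], and its neighbour there is its only neighbour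
     in [W]. *)
  have Cp : p \in W :\ i0 :\ j0.
    rewrite WC in cC Cr *.
    have [p' nbr' [eip' Cp']] := convex_leaf_neighbour tree_e cJ cC Wji Cr.
    have : p' \in neighbours_in e W i0.
      by rewrite inE eip' andbT; case/setD1P: Cp' => _ /setD1P[].
    by rewrite nbr_i => /set1P <-.
  have [q' nbr' [ejq' Cq']] := convex_leaf_neighbour tree_e cI cC Wij Cr.
  have q'q : q' = q.
    apply/set1P; rewrite -nbr_j inE ejq' andbT.
    by case/setD1P: Cq' => _ /setD1P[].
  rewrite q'q in nbr' Cq' => {q' q'q ejq'}.
  exists i0, j0, p, q; split=> //.
  have EC : E0 :\: [set edge p i0; edge j0 q] = edges_in e (W :\ i0 :\ j0).
    rewrite /E0 (edges_in_leaf tree_e nbr_i Wi) (edges_in_leaf tree_e nbr' Wij).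
    rewrite [edge p i0]edgeC; set EC := edges_in e (W :\ i0 :\ j0).
    have nj : edge j0 q \notin EC by apply: edge_notin_edges_in.
    have ni : edge i0 p \notin EC by rewrite /EC WC; apply: edge_notin_edges_in.
    apply/setP=> f; rewrite in_setD in_set2 !in_setU1.
    have [-> | fi] := eqVneq f (edge i0 p); first by rewrite (negPf ni).
    by have [-> | fj] := eqVneq f (edge j0 q); first by rewrite (negPf nj).
  rewrite /d (det_deleted_cofactor _ _ defI defJ ij Wi Wj).
  rewrite (eq_set_det (G := fun i j => sdist e aP mP x i (tperm i0 j0 j))); last first.
    by move=> i j _ _; apply: entryE.
  rewrite (convex_minor_det mP x tree_e aP_sym cI cJ cC ij Wi Wj eip Cp ejq Cq').
  rewrite EC !index_enum_set //; set c0 := #|[set v in W | (v < j0)%N]|.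
  set g0 := #|[set v in W | (j0 < v)%N]|.
  have prodE : \prod_(f in edges_in e (W :\ i0 :\ j0)) ecoef aP mP f
      = (-1) ^+ #|edges_in e (W :\ i0 :\ j0)|
        * \prod_(f in edges_in e (W :\ i0 :\ j0)) (A f * (M f * M' f - 1)).
    rewrite -prodrN; apply: eq_bigr => f _.
    by rewrite -mulrN opprB.
  (* Both sides count the vertices of [W] other than [j0], on the right split into those below and
     those above [j0]. *)
  have cardE : (#|edges_in e (W :\ i0 :\ j0)|.+2 = c0 + g0)%N.
    have C0 : W :\ i0 :\ j0 != set0 by apply/set0Pn; exists r.
    rewrite (card_edges_in tree_e C0 cC) WC.
    have -> : #|W :\ j0 :\ i0|.+1 = #|W :\ j0|.
      by rewrite (cardsD1 i0 (W :\ j0)) Wji.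
    rewrite -(cardsID [set v : 'I_n | (v < j0)%N] (W :\ j0)).
    congr (_ + _)%N; apply: eq_card => v; rewrite !inE.
      by case: (eqVneq v j0) => [->|_]; rewrite ?ltnn ?andbF.
    have -> : (j0 < v)%N = (v != j0) && (j0 <= v)%N.
      by rewrite ltn_neqAle [v == j0]eq_sym.
    rewrite -leqNgt; case: (v == j0); case: (j0 <= v)%N => //=;
      by rewrite ?andbF ?andbT.
  (* The sign from the product trades the vertices below [j0] for those above. The total sign is
     $+1$ when [i0] is the least and [j0] the greatest vertex of [W]. *)
  have signE : (-1) ^+ c0 * (-1) ^+ #|edges_in e (W :\ i0 :\ j0)|
      = (-1) ^+ g0 :> {poly R}.
    rewrite -exprD -signr_odd -[RHS]signr_odd; congr (_ ^+ _).
    have := congr1 odd cardE; rewrite /= !negbK !oddD => ->.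
    by rewrite addbA addbb.
  by rewrite exprS !exprD prodE -signE; ring.
(* The symmetric difference has twice the size of [J' :\: I], so at least two remaining rows have
   their columns deleted. *)
have D2 : (1 < #|J' :\: I|)%N.
  by rewrite ltnNge; apply: contraL S_gt2; rewrite cardS; case: #|_| => [|[]].
have /card_gt1P[b1 [b2 [/setDP[Jb1 Ib1] /setDP[Jb2 Ib2] b12]]] := D2.
rewrite /d; have [g gJ ->] := det_deleted_reindex (shifted_distance_mx e a m) card_IJ Ir.
rewrite (eq_set_det (G := fun i j => sdist e aP mP x i (g j))); last first.
  by move=> i j _ _; apply: entryE.
apply: (convex_minor_det0 _ _ _ tree_e cI cJ gJ b12 (r := r)).
- by rewrite !inE Ib1 Jb1.
- by rewrite !inE Ib2 Jb2.
- by rewrite in_setI Ir Jr.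
Qed.
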